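(* Let $I\subset\mathbb{R}$ be an interval with interior $I^{0}$, let $c>0$, and let $f,g:I\to[0,\infty)$ be such that $f$ is convex on $I^{0}$, $g$ is strongly convex on $I^{0}$ with modulus $c$, and $fg\in L[a,b]$, where $a,b\in I$ with $a<b$. Then $$\frac{1}{b-a}\int_a^b f(x)g(x)\,dx+\frac{c(b-a)^2}{6}\left[\frac{f(a)+f(b)}{2}\right]\le \frac13\left[f(a)g(a)+f(b)g(b)\right]+\frac16\left[f(a)g(b)+f(b)g(a)\right].$$
   Context: A function $h$ is called convex on an interval $J$ if $h(tx+(1-t)y)\le t h(x)+(1-t)h(y)$ for all $x,y\in J$ and $t\in[0,1]$, and strongly convex with modulus $c>0$ on $J$ if $h(tx+(1-t)y)\le t h(x)+(1-t)h(y)-ct(1-t)(x-y)^2$ for all $x,y\in J$ and $t\in(0,1)$. $L[a,b]$ denotes the space of Lebesgue integrable functions on $[a,b]$.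
   Formalization: Convexity of f and strong convexity of g are assumed on the interior of I together with the points a and b, not on the interior alone; otherwise the values at endpoints of I are unconstrained and the inequality can fail (f=1 on (0,1), f(0)=f(1)=0, g=x², c=1). *)

(* Defs.v *)
From mathcomp Require Import all_boot all_order all_algebra.
From mathcomp Require Import all_classical all_reals all_analysis.

Set Implicit Arguments.
Unset Strict Implicit.
Unset Printing Implicit Defensive.

Import Order.TTheory GRing.Theory Num.Theory.
Import numFieldNormedType.Exports.

Local Open Scope classical_set_scope.
Local Open Scope ring_scope.

(* The values of [h] outside [J] are irrelevant, and [J] is not required to be
   an interval. Plain convexity is the library's [convex_function]. *)
Definition strongly_convex_function (R : realType) (c : R) (J : set R)
    (h : R -> R) : Prop :=
  forall x y t : R, J x -> J y -> 0 < t -> t < 1 ->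
    h (t * x + (1 - t) * y) <=
      t * h x + (1 - t) * h y - c * t * (1 - t) * (x - y) ^+ 2.

(* Main.v *)
(** For x = t a + (1 - t) b the two convexity bounds, both nonnegative, multiply to
    f(x) g(x) <= (t f(a) + (1 - t) f(b)) (t g(a) + (1 - t) g(b) - c t (1 - t) (b - a)^2).
    The right-hand side is a cubic in t, whose integral over [0, 1] follows from
    int t^2 = 1/3, int t (1 - t) = 1/6 and int t^2 (1 - t) = 1/12. *)
Require Import Defs.
From mathcomp Require Import all_boot all_order all_algebra.
From mathcomp Require Import all_classical all_reals all_analysis.
From mathcomp Require Import ring.

Set Implicit Arguments.
Unset Strict Implicit.
Unset Printing Implicit Defensive.

Import Order.TTheory GRing.Theory Num.Theory.
Import numFieldNormedType.Exports.

Local Open Scope classical_set_scope.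
Local Open Scope ring_scope.

Lemma integrable_horner (R : realType) (p : {poly R}) (a b : R) :
  (@lebesgue_measure R).-integrable `[a, b] (EFin \o horner p).
Proof.
apply: continuous_compact_integrable; first exact: segment_compact.
by apply: continuous_subspaceT; exact: continuous_horner.
Qed.

(** Reduces integrating a polynomial to exhibiting a primitive: this is the fundamental theorem of
    calculus. *)
Lemma Rintegral_horner_deriv (R : realType) (p : {poly R}) (a b : R) :
  a < b ->
  \int[@lebesgue_measure R]_(x in `[a, b]) p^`().[x] = p.[b] - p.[a].
Proof.
move=> ab; rewrite /Rintegral (@continuous_FTC2 _ _ (horner p))//.
- by apply: continuous_subspaceT; exact: continuous_horner.
- split=> [x _| |]; first exact: derivable_horner.
  + by apply: cvg_at_right_filter; exact: continuous_horner.
  + by apply: cvg_at_left_filter; exact: continuous_horner.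
- by move=> x _; rewrite -derivE.
Qed.

Lemma convex_function_segment (R : realType) (J : set R) (h : R -> R)
    (x y t : R) :
  convex_function J h -> J x -> J y -> 0 <= t -> t <= 1 ->
  h (t * x + (1 - t) * y) <= t * h x + (1 - t) * h y.
Proof.
move=> hJ Jx Jy t0 t1.
have t01 : t \in `[0, 1] by rewrite in_itv/= t0.
have := hJ (Itv01 t0 t1) x y; rewrite !inE => /(_ Jx Jy).
by rewrite !convRE.
Qed.

(** At [t = 0] and [t = 1] the quadratic term vanishes and both sides agree, so the open range of
    [t] extends to the closed one. *)
Lemma strongly_convex_function_segment (R : realType) (c : R) (J : set R)
    (h : R -> R) (x y t : R) :
  strongly_convex_function c J h -> J x -> J y -> 0 <= t -> t <= 1 ->
  h (t * x + (1 - t) * y) <=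
    t * h x + (1 - t) * h y - c * t * (1 - t) * (x - y) ^+ 2.
Proof.
move=> hJ Jx Jy; rewrite le_eqVlt => /predU1P[<- _|t0].
  by rewrite !(mul0r, mulr0, subr0, mul1r, add0r).
rewrite le_eqVlt => /predU1P[->|t1]; last exact: hJ.
by rewrite !(subrr, mul0r, mulr0, subr0, mul1r, addr0).
Qed.

Theorem theorem6 (R : realType) (I : set R) (c a b : R) (f g : R -> R)
  (hI : is_interval I)
  (hc : 0 < c)
  (hf0 : forall x, I x -> 0 <= f x)
  (hg0 : forall x, I x -> 0 <= g x)
  (ha : I a) (hb : I b) (hab : a < b)
  (* [I° `|` [set a; b]] is [I°] itself unless a or b is an endpoint of [I] *)
  (hf : convex_function (I° `|` [set a; b] : set R) f)
  (hg : strongly_convex_function c (I° `|` [set a; b]) g)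
  (hfg : (@lebesgue_measure R).-integrable `[a, b]
           (fun x => (f x * g x)%:E)) :
  1 / (b - a) * (\int[@lebesgue_measure R]_(x in `[a, b]) (f x * g x))
    + c * (b - a) ^+ 2 / 6 * ((f a + f b) / 2)
  <= 1 / 3 * (f a * g a + f b * g b)
     + 1 / 6 * (f a * g b + f b * g a).
Proof.
have ba0 : 0 < b - a by rewrite subr_gt0.
have ban0 : b - a != 0 by rewrite gt_eqF.
have Ja : (I° `|` [set a; b]) a by right; left.
have Jb : (I° `|` [set a; b]) b by right; right.
pose k := c * (b - a) ^+ 2.
(* [t x] is the weight of [a] when [x] is written as a convex combination of [a] and [b]; [q] is the
   same map as a polynomial. *)
pose t x := (b - x) / (b - a).
pose q : {poly R} := (b - a)^-1 *: (b%:P - 'X).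
(* [p1], [p2], [p3] are the coefficients of [t], [t^2], [t^3] in [(f b + (f a - f b) t) (g b + (g a
   - g b - k) t + k t^2)]. *)
pose p1 := f b * (g a - g b - k) + (f a - f b) * g b.
pose p2 := f b * k + (f a - f b) * (g a - g b - k).
pose p3 := (f a - f b) * k.
(* The derivative of [p] is the cubic upper bound of [f x * g x], expanded in
   powers of [t x]; the factor [- (b - a)] comes from [t]. *)
pose p : {poly R} := - (b - a) *:
  ((f b * g b) *: q + (p1 / 2) *: q ^+ 2 + (p2 / 3) *: q ^+ 3
    + (p3 / 4) *: q ^+ 4).
have pE x : p.[x] = - (b - a) * (f b * g b * t x + p1 / 2 * t x ^+ 2
    + p2 / 3 * t x ^+ 3 + p3 / 4 * t x ^+ 4).
  by rewrite /p /q !hornerE/= /t; field.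
have dpE x : p^`().[x] = (t x * f a + (1 - t x) * f b) *
    (t x * g a + (1 - t x) * g b - c * t x * (1 - t x) * (a - b) ^+ 2).
  rewrite /p /q !(derivZ, derivD, derivX, derivN, derivC, deriv_exp).
  rewrite !hornerE/= /t /p1 /p2 /p3 /k.
  by field.
have fg_le x : `[a, b]%classic x -> f x * g x <= p^`().[x].
  rewrite /= in_itv/= => /andP[ax xb].
  have Ix : I x by apply: (hI a b) => //; rewrite ax.
  have t0 : 0 <= t x by rewrite divr_ge0 ?subr_ge0// ltW.
  have t1 : t x <= 1 by rewrite ler_pdivrMr// mul1r lerB.
  have xE : x = t x * a + (1 - t x) * b by rewrite /t; field.
  rewrite dpE; apply: ler_pM; [exact: hf0|exact: hg0|..].
  (* Only the [x] under [f] is expanded; those inside [t x] must stay. *)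
  - by rewrite {1}xE; exact: convex_function_segment hf Ja Jb t0 t1.
  - by rewrite {1}xE; exact: strongly_convex_function_segment hg Ja Jb t0 t1.
have int_le : \int[@lebesgue_measure R]_(x in `[a, b]) (f x * g x)
    <= p.[b] - p.[a].
  rewrite -Rintegral_horner_deriv//; apply: le_Rintegral => //.
  exact: integrable_horner.
have tb : t b = 0 by rewrite /t subrr mul0r.
have ta : t a = 1 by rewrite /t divff.
(* Only [p.[a]] contributes, as [t b = 0]; the value is the integral of the cubic over [[0, 1]]. *)
have pab : 1 / (b - a) * (p.[b] - p.[a]) =
    f b * g b + p1 / 2 + p2 / 3 + p3 / 4.
  by rewrite !pE ta tb; field.
have := ler_wpM2l (ltW (divr_gt0 ltr01 ba0)) int_le.
rewrite pab => int_le'; rewrite -lerBrDr; apply: le_trans int_le' _.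
(* No slack remains: the [k] terms add up to [- k (f a + f b) / 12], and the two sides are equal. *)
rewrite le_eqVlt; apply/orP; left; apply/eqP.
by rewrite /p1 /p2 /p3 /k; field.
Qed.
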